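(* Let $k$ be a nonnegative integer, let $k<\alpha<k+1$, and let $u$ be analytic on $[-1,1]$. Let $u_{NL}$ and $u_{NR}$ ($N\ge k$) be the left and right one-point Hermite interpolants of $u$ with parameter $k$ defined in the context. Then $$\big\Vert {}_{-1}D_x^{\alpha}(u-u_{NL})\big\Vert_{L^\infty[-1,1]}\le\frac{2^{k+1-\alpha}}{\Gamma(k+2-\alpha)}\big\Vert(u-u_{NL})^{(k+1)}\big\Vert_{L^\infty[-1,1]},$$ $$\big\Vert {}_{x}D_1^{\alpha}(u-u_{NR})\big\Vert_{L^\infty[-1,1]}\le\frac{2^{k+1-\alpha}}{\Gamma(k+2-\alpha)}\big\Vert(u-u_{NR})^{(k+1)}\big\Vert_{L^\infty[-1,1]}.$$
   Context: Riemann–Liouville integrals, for $\gamma\in(0,1)$: ${}_{-1}I_x^\gamma u(x)=\frac1{\Gamma(\gamma)}\int_{-1}^x\frac{u(\tau)}{(x-\tau)^{1-\gamma}}d\tau$ and ${}_xI_1^\gamma u(x)=\frac1{\Gamma(\gamma)}\int_x^1\frac{u(\tau)}{(\tau-x)^{1-\gamma}}d\tau$. Riemann–Liouville derivatives, for $\alpha\in(k,k+1)$, with $D=d/dx$: ${}_{-1}D_x^\alpha u=D^{k+1}\big({}_{-1}I_x^{k+1-\alpha}u\big)$ and ${}_xD_1^\alpha u=(-1)^{k+1}D^{k+1}\big({}_xI_1^{k+1-\alpha}u\big)$. $\mathcal{P}_N$ is the space of polynomials of degree at most $N$; $P_n^{a,b}$ is the classical Jacobi polynomial of degree $n$ (orthogonal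 on $[-1,1]$ with weight $(1-x)^a(1+x)^b$). (L) Let $\tilde n=N-k$ and let $-1=x_0<x_1<\cdots<x_{\tilde n}<1$ be the distinct zeros of $(1+x)^{k+1}P^{0,k+1}_{\tilde n}(x)$. $u_{NL}\in\mathcal{P}_N$ is the unique polynomial with $u_{NL}^{(j)}(-1)=u^{(j)}(-1)$ for $j=0,\dots,k$ and $u_{NL}(x_i)=u(x_i)$ for $i=1,\dots,\tilde n$. (R) Let $\tilde n=N-k$ and let $-1<x_0<\cdots<x_{\tilde n}=1$ be the distinct zeros of $(1-x)^{k+1}P^{k+1,0}_{\tilde n}(x)$. $u_{NR}\in\mathcal{P}_N$ is the unique polynomial with $u_{NR}^{(j)}(1)=u^{(j)}(1)$ for $j=0,\dots,k$ and $u_{NR}(x_i)=u(x_i)$ for $i=0,\dots,\tilde n-1$. *)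

(* Defs.v *)
From HB Require Import structures.
From mathcomp Require Import all_boot all_order all_algebra.
From mathcomp Require Import all_classical all_reals all_analysis.
Set Implicit Arguments.
Unset Strict Implicit.
Unset Printing Implicit Defensive.
Import Order.TTheory GRing.Theory Num.Theory.
Import numFieldNormedType.Exports.
Local Open Scope classical_set_scope.
Local Open Scope ring_scope.

Definition Gamma (R : realType) (s : R) : R :=
  \int[lebesgue_measure]_(t in `]0, +oo[) (t `^ (s - 1) * expR (- t)).

(* At the endpoint t = x the integrand takes the junk value 0, on a null set. *)
Definition left_RL_integral (R : realType) (g : R) (u : R -> R) (x : R) : R :=
  (Gamma g)^-1 *
    \int[lebesgue_measure]_(t in `[-1, x]) (u t / (x - t) `^ (1 - g)).

Definition right_RL_integral (R : realType) (g : R) (u : R -> R) (x : R) : R :=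
  (Gamma g)^-1 *
    \int[lebesgue_measure]_(t in `[x, 1]) (u t / (t - x) `^ (1 - g)).

(* Riemann-Liouville derivatives of order alpha, for k < alpha < k.+1. *)
Definition left_RL_derivative (R : realType) (k : nat) (alpha : R)
    (u : R -> R) (x : R) : R :=
  derive1n k.+1 (left_RL_integral (k.+1%:R - alpha) u) x.

Definition right_RL_derivative (R : realType) (k : nat) (alpha : R)
    (u : R -> R) (x : R) : R :=
  (-1) ^+ k.+1 * derive1n k.+1 (right_RL_integral (k.+1%:R - alpha) u) x.

(* derive1n is total and returns a default value where the limit does not
   exist; these predicates say that the outer derivatives do exist throughout
   the open interval. *)
Definition derivable_n_in (R : realType) (n : nat) (f : R -> R) (D : set R) :=
  forall j, (j < n)%N -> forall x, D x -> derivable (derive1n j f) x 1.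

Definition left_RL_derivable (R : realType) (k : nat) (alpha : R)
    (u : R -> R) : Prop :=
  derivable_n_in k.+1 (left_RL_integral (k.+1%:R - alpha) u) `]-1, 1[.

Definition right_RL_derivable (R : realType) (k : nat) (alpha : R)
    (u : R -> R) : Prop :=
  derivable_n_in k.+1 (right_RL_integral (k.+1%:R - alpha) u) `]-1, 1[.

Definition Linfty_norm (R : realType) (f : R -> R) : \bar R :=
  ('N[lebesgue_measure]_+oo[(EFin \o f) \_ `[(-1)%R, 1%R]])%E.

(* Real-analytic at each point of A; the power series converges on a two-sided
   neighbourhood, also at boundary points of A. *)
Definition analytic_on (R : realType) (A : set R) (u : R -> R) : Prop :=
  forall c, A c -> exists a : R^nat,
    \forall y \near c, pseries a (y - c) @ \oo --> u y.

Definition gbinomial (R : realType) (z : R) (m : nat) : R :=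
  (\prod_(i < m) (z - i%:R)) / m`!%:R.

(* Szego's explicit form (Orthogonal Polynomials, 4.3.2), which has the
   normalization P_n^{a,b}(1) = binomial(n + a, n). *)
Definition jacobi (R : realType) (a b : R) (n : nat) : {poly R} :=
  \sum_(s < n.+1)
    (gbinomial (n%:R + a) (n - s) * gbinomial (n%:R + b) s) *:
      ((2^-1 *: ('X - 1)) ^+ s * (2^-1 *: ('X + 1)) ^+ (n - s)).

Definition left_nodes (R : realType) (k n : nat) (x : 'I_n.+1 -> R) : Prop :=
  [/\ forall i j : 'I_n.+1, (i < j)%N -> x i < x j,
      x ord0 = -1,
      x ord_max < 1 &
      forall y, root ((1 + 'X) ^+ k.+1 * jacobi 0 k.+1%:R n) y <->
                exists i, y = x i].

Definition right_nodes (R : realType) (k n : nat) (x : 'I_n.+1 -> R) : Prop :=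
  [/\ forall i j : 'I_n.+1, (i < j)%N -> x i < x j,
      -1 < x ord0,
      x ord_max = 1 &
      forall y, root ((1 - 'X) ^+ k.+1 * jacobi k.+1%:R 0 n) y <->
                exists i, y = x i].

Definition left_hermite_interpolant (R : realType) (k N : nat)
    (x : 'I_(N - k).+1 -> R) (u : R -> R) (p : {poly R}) : Prop :=
  [/\ (size p <= N.+1)%N,
      forall j, (j <= k)%N -> p^`(j).[-1] = derive1n j u (-1) &
      forall i : 'I_(N - k).+1, i != ord0 -> p.[x i] = u (x i)].

Definition right_hermite_interpolant (R : realType) (k N : nat)
    (x : 'I_(N - k).+1 -> R) (u : R -> R) (p : {poly R}) : Prop :=
  [/\ (size p <= N.+1)%N,
      forall j, (j <= k)%N -> p^`(j).[1] = derive1n j u 1 &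
      forall i : 'I_(N - k).+1, i != ord_max -> p.[x i] = u (x i)].

(* Main.v *)
Require Import Defs.
From HB Require Import structures.
From mathcomp Require Import all_boot all_order all_algebra.
From mathcomp Require Import all_classical all_reals all_analysis.
From mathcomp Require Import measurable_realfun ess_sup_inf ring lra.
Set Implicit Arguments.
Unset Strict Implicit.
Unset Printing Implicit Defensive.
Import Order.TTheory GRing.Theory Num.Theory.
Import numFieldNormedType.Exports.
Local Open Scope classical_set_scope.
Local Open Scope ring_scope.

(** Write [g = k + 1 - alpha], so that [0 < g < 1], and let [e] be the
    interpolation error.  Only two properties of [e] matter: it is smooth near
    every point of [[-1, 1]], because [u] is analytic and the interpolant is a
    polynomial, and its derivatives of order at most [k] vanish at the base
    point ([-1] on the left, [1] on the right).

    The fractional integral of order [g] is the convolution of the extension of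
    [e] by zero outside [[-1, 1]] with the kernel [s ^ (g - 1) / Gamma g].  If a
    smooth function vanishes at the base point, its extension by zero agrees, on
    the part of the line that the convolution sees, with a Lipschitz function
    (the function composed with the retraction of the line on [[-1, 1]]), so
    the derivative may be moved under the integral by dominated convergence:
    [D (I^g f) = I^g (D f)] (lemma [is_derive_power_conv_extension]).  The
    Hermite conditions permit [k + 1] such steps, whence
    [D^(k+1) (I^g e) = I^g (e^(k+1))], that is, the Riemann-Liouville and the
    Caputo derivatives of [e] coincide (lemma [derive1n_RL_integral]).

    The bound is then the [L^1] norm of the kernel over [[0, 2]] times the
    essential supremum of [e^(k+1)]: that norm is [2 ^ g / (g * Gamma g)], and
    [g * Gamma g = Gamma (g + 1)] (lemma [Gamma_functional]).

    The two sides are treated at once.  A boolean [b] selects the direction, and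
    the change of variables [t = x - (-1) ^ b * s] turns both integrals into
    integrals over the same interval [[0, 2]], with base point [- (-1) ^ b]. *)

(** * Derivatives of analytic functions *)

Section analytic.
Variable R : realType.
Implicit Types (a : R^nat) (u v : R -> R) (A : set R).

Lemma natmul_exp_le (x r : R) n : 0 <= x -> x <= r ->
  n.+1%:R * x ^+ n * (r - x) <= r ^+ n.+1 - x ^+ n.+1.
Proof.
move=> x0 xr; elim: n => [|n IH]; first by rewrite expr0 !expr1; lra.
have xn0 : 0 <= x ^+ n.+1 by rewrite exprn_ge0.
have xrn : x ^+ n.+1 <= r ^+ n.+1 by rewrite lerXn2r ?nnegrE// (le_trans x0).
have {}IH := ler_wpM2l x0 IH.
rewrite -natr1 (exprS r n.+1) [x ^+ n.+2]exprS.
have -> : (n.+1%:R + 1) * x ^+ n.+1 * (r - x) =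
  x * (n.+1%:R * x ^+ n * (r - x)) + x ^+ n.+1 * (r - x) by rewrite exprS; ring.
nra.
Qed.

(** The termwise derivative converges in the open disc: the terms of the series
    at [K] are bounded, and between [`|z|] and an intermediate radius [r] the
    factor [n + 1] is absorbed by [natmul_exp_le], which leaves a geometric
    series of ratio [r / `|K|]. *)
Lemma is_cvg_pseries_diffs a (K z : R) :
  cvgn (pseries a K) -> `|z| < `|K| -> cvgn (pseries (pseries_diffs a) z).
Proof.
move=> aK zK.
have [r zr rK] : exists2 r : R, `|z| < r & r < `|K|.
  by exists ((`|z| + `|K|) / 2); lra.
have z0 := normr_ge0 z.
have [M [_ aM]] := cvg_series_bounded aK.
have {}aM n : `|a n * K ^+ n| <= `|M| + 1.
  apply: aM => //; rewrite (le_lt_trans (ler_norm _))// ltrDl//.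
have K0 : 0 < `|K| by lra.
have M0 : 0 <= `|M| + 1 by rewrite addr_ge0.
have r0 : 0 <= r by lra.
have rz0 : 0 <= r - `|z| by lra.
apply: normed_cvg.
apply: (@series_le_cvg _ _
  (geometric ((`|M| + 1) / (r - `|z|) * (r / `|K|)) (r / `|K|))) => [n||n|].
- exact: normr_ge0.
- by move=> n; rewrite /geometric /= !(mulr_ge0, exprn_ge0, invr_ge0).
- rewrite /pseries_diffs /geometric /=.
  rewrite !normrM normrX (@ger0_norm _ n.+1%:R)//.
  have h := natmul_exp_le n z0 (ltW zr).
  have {}h : n.+1%:R * `|z| ^+ n * (r - `|z|) <= r ^+ n.+1.
    by rewrite (le_trans h)// lerBlDr lerDl exprn_ge0.
  have := aM n.+1; rewrite normrM normrX => aMn.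
  have -> : (`|M| + 1) / (r - `|z|) * (r / `|K|) * (r / `|K|) ^+ n =
      (`|M| + 1) * r ^+ n.+1 / (r - `|z|) / `|K| ^+ n.+1.
    by rewrite -mulrA -exprS expr_div_n; ring.
  rewrite ler_pdivlMr ?exprn_gt0// ler_pdivlMr ?subr_gt0//.
  have -> : n.+1%:R * `|a n.+1| * `|z| ^+ n * `|K| ^+ n.+1 * (r - `|z|) =
    (`|a n.+1| * `|K| ^+ n.+1) * (n.+1%:R * `|z| ^+ n * (r - `|z|)) by ring.
  by apply: ler_pM => //; rewrite mulr_ge0 ?mulr_ge0 ?exprn_ge0.
- apply: is_cvg_geometric_series.
  by rewrite normrM normfV normr_id ltr_pdivrMr// mul1r ger0_norm.
Qed.

(** The derivative is given near [c] by the differentiated series; giving this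
    next to differentiability is what lets the argument be iterated. *)
Lemma near_pseries_derive1 a u (c : R) :
  (\forall y \near c, pseries a (y - c) @ \oo --> u y) ->
  \forall y \near c, derivable u y 1 /\
    pseries (pseries_diffs a) (y - c) @ \oo --> derive1 u y.
Proof.
move=> /nbhs_ballP[r /= r0 ru].
have uE y : ball c r y -> u y = limn (pseries a (y - c)).
  by move=> /ru /= h; apply/esym/cvg_lim.
have rl t : 0 < t -> t < 1 -> cvgn (pseries a (t * r)).
  move=> t0 t1; have : ball c r (c + t * r).
    rewrite /ball/= opprD addNKr normrN ger0_norm ?mulr_ge0// ?ltW//.
    by rewrite gtr_pMl.
  by move=> /ru; rewrite addrAC subrr add0r => h; apply/cvg_ex; exists (u (c + t * r)).
have n2 (t : R) : 0 < t -> `|t * r| = t * r by move=> t0; rewrite ger0_norm// mulr_ge0// ltW.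
(* Differentiating the sum requires the series and its first two termwise
   derivatives to converge at one point; each termwise derivative costs some
   radius, hence the points r / 2, r / 3 and r / 4. *)
have c1 : cvgn (pseries (pseries_diffs a) (3^-1 * r)).
  apply: (is_cvg_pseries_diffs (rl 2^-1 _ _)); try lra.
  by rewrite !n2; [rewrite ltr_pM2r//; lra|lra|lra].
have c0 : cvgn (pseries a (4^-1 * r)) by apply: rl; lra.
have lt43 : `|4^-1 * r| < `|3^-1 * r|.
  by rewrite !n2; [rewrite ltr_pM2r//; lra|lra|lra].
have c2 : cvgn (pseries (pseries_diffs a) (4^-1 * r)).
  exact: is_cvg_pseries_inside c1 lt43.
have c3 := is_cvg_pseries_diffs c1 lt43.
apply/nbhs_ballP; exists (4^-1 * r) => /=; first by rewrite mulr_gt0//; lra.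
move=> y yc.
have yc' : `|y - c| < `|4^-1 * r| by rewrite n2; [rewrite distrC|lra].
have D : is_derive y 1 u (limn (pseries (pseries_diffs a) (y - c))).
  apply: (@near_eq_is_derive _ _ _ (fun y => limn (pseries a (y - c)))).
    have yr : ball c r y.
      by apply: le_ball yc; rewrite ler_piMl ?ltW//; lra.
    near=> w; apply/esym/uE.
    by near: w; apply: open_nbhs_nbhs; split => //; exact: ball_open.
  have := pseries_snd_diffs c0 c2 c3 yc' => d.
  have dB : is_derive y (1 : R) (fun w : R => w - c) 1.
    by apply: is_derive_eq; rewrite subr0.
  have := @is_derive1_comp _ (fun x => limn (pseries a x)) (fun w : R => w - c) y _ _ d dB.
  by rewrite mulr1.
split; first by case: D.
rewrite derive1E (@derive_val _ _ _ _ _ _ _ D).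
exact: is_cvg_pseries_inside c2 yc'.
Unshelve. all: by end_near. Qed.

(** Differentiability near the point rather than at it, since the next
    derivative only has a meaning where the previous one exists nearby. *)
Definition smooth_at u (c : R) := forall j, \forall y \near c, derivable (derive1n j u) y 1.

Lemma analytic_smooth A u c : analytic_on A u -> A c -> smooth_at u c.
Proof.
move=> uA Ac; have {uA Ac} [a ua] := uA _ Ac.
move=> j; elim: j u a ua => [|j IH] u a ua.
  have := near_pseries_derive1 ua; rewrite derive1n0.
  by apply: filterS => y [+ _]; apply.
rewrite derive1Sn.
apply: (IH _ (pseries_diffs a)).
by apply: filterS (near_pseries_derive1 ua) => y [].
Qed.

Lemma smooth_near_derive1n_subr_horner u (p : {poly R}) c j : smooth_at u c ->
  \forall y \near c,
    derive1n j (fun t => u t - p.[t]) y = derive1n j u y - p^`(j).[y].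
Proof.
move=> us; elim: j => [|j IH].
  by apply: filterE => y.
have := us j; move: IH => /near_join IH uj.
near=> y.
rewrite !derive1nS derivnS derive1E.
have -> : 'D_1 (derive1n j (fun t => u t - p.[t])) y =
    'D_1 (fun y => derive1n j u y - p^`(j).[y]) y.
  by apply: near_eq_derive; near: y.
have d1 : derivable (derive1n j u) y 1 by near: y.
have d2 : derivable (fun y => p^`(j).[y]) y 1 by exact: derivable_horner.
rewrite (deriveB d1 d2) -derive1E.
congr (_ - _); rewrite -derive1E.
by rewrite derivE.
Unshelve. all: by end_near. Qed.

Lemma smooth_subr_horner u (p : {poly R}) c : smooth_at u c ->
  smooth_at (fun t => u t - p.[t]) c.
Proof.
move=> us j.
have := us j; have := smooth_near_derive1n_subr_horner p j us.
move=> /near_join IH uj; near=> y.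
apply: (@near_eq_derivable _ _ _ (fun y => derive1n j u y - p^`(j).[y])).
  apply: filterS (_ : \forall z \near y,
    derive1n j (fun t => u t - p.[t]) z = derive1n j u z - p^`(j).[z]).
    by move=> z ->.
  by near: y.
have d1 : derivable (derive1n j u) y 1 by near: y.
by apply: (derivableB d1); exact: derivable_horner.
Unshelve. all: by end_near. Qed.

End analytic.

(** * The power kernel and the Gamma function *)

Section kernel.
Variable R : realType.
Local Notation mu := (@lebesgue_measure R).

(** The kernel is singular at 0, so the fundamental theorem of calculus is used
    on the intervals [[t / (n + 1), t]], which exhaust [(0, t]]. *)
Lemma integral_powR_itv0 (g t : R) : 0 < g -> 0 <= t ->
  (\int[mu]_(s in `[0%R, t]) (s `^ (g - 1))%:E = (t `^ g / g)%:E)%E.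
Proof.
move=> g0; rewrite le_eqVlt => /predU1P[<-|t0].
  by rewrite set_itv1 integral_set1 powR0 ?gt_eqF// mul0r.
have mp (D : set R) : measurable_fun D (fun s : R => s `^ (g - 1)).
  by apply: measurable_funTS; exact: measurable_powR.
rewrite -integral_itv_obnd_cbnd; last by apply/measurable_EFinP; exact: mp.
pose F n := `[t / n.+1%:R, t]%classic.
have FE : `]0, t]%classic = \bigcup_n F n.
  apply/seteqP; split => [x /=|x [n _]]; rewrite /F/= !in_itv/=.
    move=> /andP[x0 xt]; exists (Num.trunc (t / x)) => //=; rewrite /F/= in_itv/= xt andbT.
    rewrite ler_pdivrMr// mulrC -ler_pdivrMr// ltW//.
    by rewrite truncnS_gt.
  by move=> /andP[tx ->]; rewrite andbT (lt_le_trans _ tx)// divr_gt0.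
rewrite FE.
have cF : (\int[mu]_(x in F i) (x `^ (g - 1))%:E @[i --> \oo] -->
    \int[mu]_(x in \bigcup_i F i) (x `^ (g - 1))%:E)%E.
  apply: ge0_nondecreasing_set_cvg_integral => //.
  - apply/nondecreasing_seqP => n; rewrite subsetEset; apply: subset_itvr.
    by rewrite bnd_simp ler_pM2l// lef_pV2 ?posrE// ler_nat.
  - by move=> n; exact: measurable_itv.
  - by move=> n; apply/measurable_EFinP; exact: mp.
  - by move=> n x _; rewrite lee_fin powR_ge0.
have dP (x : R) : 0 < x -> is_derive x (1 : R) (fun x => x `^ g / g) (x `^ (g - 1)).
  move=> x0; have := is_derive1_powR g x0 => d.
  have -> : (fun x : R => x `^ g / g) = (fun x => g^-1 *: (x `^ g)).
    by apply/funext => y; rewrite /= mulrC.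
  apply: is_derive_eq.
  by rewrite /GRing.scale/= mulrA mulVf ?mul1r// gt_eqF.
have IE n : (\int[mu]_(x in F n) (x `^ (g - 1))%:E =
   (t `^ g / g)%:E - ((t / n.+1%:R) `^ g / g)%:E)%E.
  have [n0|n0] := eqVneq n 0.
    by rewrite /F n0 divr1 set_itv1 integral_set1 -EFinB subrr.
  have tn0 : 0 < t / n.+1%:R by rewrite divr_gt0.
  apply: (continuous_FTC2 (F := fun x => x `^ g / g)) => [||| x].

  - by rewrite ltr_pdivrMr// ltr_pMr// ltr1n ltnS lt0n.
  - apply: derivable_within_continuous => x; rewrite in_itv/= => /andP[nx _].
    by apply: derivable_powR; rewrite in_itv/= andbT (lt_le_trans tn0).
  - have cP x : 0 < x -> {for x, continuous (fun x => x `^ g / g)}.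
      by move=> /dP[? _]; apply: differentiable_continuous; exact/derivable1_diffP.
    split.
    + move=> x; rewrite in_itv/= => /andP[nx _].
      by have [] := dP x (lt_trans tn0 nx).
    + by apply: cvg_at_right_filter; exact: cP.
    + by apply: cvg_at_left_filter; exact: cP.
  - rewrite in_itv/= => /andP[nx _].
    rewrite derive1E; have d := dP x (lt_trans tn0 nx).
    by rewrite derive_val.
apply: (cvg_unique _ cF) => //.
rewrite (_ : (fun _ => _) = (fun n => (t `^ g / g - (t / n.+1%:R) `^ g / g)%:E)); last first.
  by apply/funext => n; rewrite IE.
apply: cvg_EFin; first exact: nearW.
rewrite -[X in _ --> X]subr0 -[X in _ --> _ - X](mul0r g^-1).
apply: cvgB; first exact: cvg_cst.
apply: cvgMr_tmp.
have h := @powR_cvg0 R g g0.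
have /cvg_at_rightP := h; apply; split.
  by move=> n; rewrite divr_gt0.
rewrite -[X in _ --> X](mulr0 t); apply: cvgMl_tmp.
exact: cvg_harmonic.
Qed.

Lemma integrable_powR_itv0 (g t : R) : 0 < g -> 0 <= t ->
  mu.-integrable `[0, t] (fun s => (s `^ (g - 1))%:E).
Proof.
move=> g0 t0; apply/integrableP; split.
  by apply/measurable_EFinP; apply: measurable_funTS; exact: measurable_powR.
under eq_integral do rewrite /= ger0_norm ?powR_ge0//.
by rewrite integral_powR_itv0// ltry.
Qed.

Lemma integral_expRN (s : R) :
  (\int[mu]_(t in `[s, +oo[) (expR (- t))%:E = (expR (- s))%:E)%E.
Proof.
rewrite (@ge0_continuous_FTC2y _ _ (fun t => - expR (- t)) _ 0).
- by rewrite sub0e -EFinN opprK.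
- by move=> x _; exact: expR_ge0.
- apply: continuous_subspaceT => x.
  by apply: continuous_comp; [exact: opp_continuous|exact: continuous_expR].
- by rewrite -oppr0; apply: cvgN; exact: cvgr_expR.
- by move=> x _.
- apply: cvg_at_right_filter; apply: cvgN.
  by apply: continuous_comp; [exact: opp_continuous|exact: continuous_expR].
- move=> x _; rewrite derive1E.
  have d : is_derive x (1 : R) (fun t => - expR (- t)) (expR (-x)).
    by apply: is_derive_eq; rewrite /GRing.scale/=; ring.
  by rewrite derive_val.
Qed.

(** Writing [t^g] as the integral of [g s^(g-1)] over [[0, t]] turns the functional
    equation into an exchange of integrals of a nonnegative function on the
    region [s <= t].  The exchange holds in the extended reals, so it asks for
    no convergence. *)
Lemma Gamma_functional (g : R) : 0 < g -> Gamma (g + 1) = g * Gamma g.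
Proof.
move=> g0; rewrite /Gamma addrK /Rintegral.
pose f (z : measurableTypeR R * measurableTypeR R) : \bar R :=
  (((0 < z.1) && (z.1 <= z.2))%:R * (g * z.1 `^ (g - 1) * expR (- z.2)))%:E.
have f0 z : (0 <= f z)%E.
  by rewrite lee_fin mulr_ge0 ?ler0n// mulr_ge0 ?expR_ge0// mulr_ge0 ?powR_ge0// ltW.
have mf : measurable_fun setT f.
  apply/measurable_EFinP/measurable_funM.
    apply: (@measurableT_comp _ _ _ _ _ _ (fun b : bool => b%:R : R)) => //.
    apply: measurable_and.
      exact: measurable_fun_ltr.
    exact: measurable_fun_ler.
  apply: measurable_funM.
    apply: measurable_funM => //.
    by apply: (measurableT_comp (measurable_powR _)).
  apply: measurableT_comp => //; exact: measurableT_comp.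
have := fubini_tonelli (m1 := mu) (m2 := mu) _ mf f0.
have -> : (\int[mu]_x \int[mu]_y f (x, y) =
    \int[mu]_(x in `]0%R, +oo[) (g%:E * (x `^ (g - 1) * expR (- x))%:E))%E.
  rewrite [RHS]integral_mkcond; apply: eq_integral => s _.
  rewrite patchE; case: ifPn => s0; last first.
    rewrite integral0_eq// => y _; rewrite /f/=.
    by move: s0; rewrite notin_setE/= in_itv/= andbT => /negP/negbTE ->; rewrite mul0r.
  move: s0; rewrite inE/= in_itv/= andbT => s0.
  transitivity (\int[mu]_(y in `[s, +oo[) ((g * s `^ (g - 1))%:E * (expR (- y))%:E))%E.
    rewrite [RHS]integral_mkcond; apply: eq_integral => y _.
    rewrite /f/= patchE s0/= mem_setE in_itv/= andbT.
    by case: ifPn => _; rewrite ?mul1r ?mul0r.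
  rewrite ge0_integralZl//=.
  - by rewrite integral_expRN -!EFinM mulrA.
  - apply/measurable_EFinP; apply: measurable_funTS.
    apply: measurableT_comp => //; exact: measurable_expR.
  - by rewrite lee_fin mulr_ge0 ?powR_ge0 ?ltW.
have -> : (\int[mu]_y \int[mu]_x f (x, y) =
    \int[mu]_(x in `]0%R, +oo[) (x `^ g * expR (- x))%:E)%E.
  rewrite [RHS]integral_mkcond; apply: eq_integral => t _.
  rewrite patchE; case: ifPn => t0; last first.
    rewrite integral0_eq// => y _; rewrite /f/=.
    move: t0; rewrite notin_setE/= in_itv/= andbT => /negP t0.
    case: (boolP (_ && _)); rewrite ?mul0r// => /andP[y0 yt].
    by rewrite (lt_le_trans y0 yt) in t0.
  move: t0; rewrite inE/= in_itv/= andbT => t0.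
  transitivity (\int[mu]_(s in `]0%R, t]) ((g * expR (- t))%:E * (s `^ (g - 1))%:E))%E.
    rewrite [RHS]integral_mkcond; apply: eq_integral => y _.
    rewrite /f/= patchE mem_setE in_itv/=.
    case: ifPn => _; rewrite ?mul1r ?mul0r//.
    by rewrite -EFinM; congr EFin; ring.
  have mp (D : set R) : measurable_fun D (fun s : R => s `^ (g - 1)).
    by apply: measurable_funTS; exact: measurable_powR.
  rewrite ge0_integralZl//=.
  - rewrite integral_itv_obnd_cbnd; last by apply/measurable_EFinP; exact: mp.
    rewrite integral_powR_itv0 ?ltW// -EFinM; congr EFin.
    by field; rewrite gt_eqF.
  - by apply/measurable_EFinP; exact: mp.
  - by move=> y _; rewrite lee_fin powR_ge0.
  - by rewrite lee_fin mulr_ge0 ?expR_ge0 ?ltW.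
move=> <-.
rewrite ge0_integralZl//=.
- set I := (X in (_ * X)%E).
  have : (0 <= I)%E.
    by apply: integral_ge0 => x _; rewrite lee_fin mulr_ge0 ?powR_ge0 ?expR_ge0.
  suff gI : (0 <= I)%E -> fine (g%:E * I)%E = g * fine I by exact: gI.
  case: I => [r _|_|//]; first by [].
  by rewrite gt0_muley ?lte_fin// [RHS]mulr0.
- apply/measurable_EFinP; apply: measurable_funTS; apply: measurable_funM.
    exact: measurable_powR.
  exact: measurableT_comp.
- by move=> y _; rewrite lee_fin mulr_ge0 ?powR_ge0 ?expR_ge0.
- by rewrite lee_fin ltW.
Qed.
End kernel.

(** * Reflections and convolution with the power kernel *)

Section reflection.
Variable R : realType.
Local Notation mu := (@lebesgue_measure R).

Definition reflection (b : bool) (x s : R) : R := x - (-1) ^+ b * s.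

Lemma measurable_reflection b x :
  measurable_fun setT (reflection b x : measurableTypeR R -> measurableTypeR R).
Proof.
by apply: measurable_funB => //; exact: measurable_funM.
Qed.

Lemma pushforward_reflection b x (A : set R) : measurable A ->
  pushforward mu (reflection b x : measurableTypeR R -> measurableTypeR R) A = mu A.
Proof.
move=> mA; apply/esym/lebesgue_measure_unique => //=.
  exact: measurable_reflection.
move=> {A mA} + _ [[a c]] _ <- => _.
rewrite /pushforward/=; case: b.
  rewrite [X in _ = mu X](_ : _ = `]a - x, c - x]%classic); last first.
    apply/seteqP; split => y /=; rewrite !in_itv/= /reflection
      mulr_sign/= =>  /andP[? ?];
      apply/andP; split; lra.
  rewrite !lebesgue_measure_itv/= !lte_fin ltrD2r; case: ifPn => // _.
  by rewrite -!EFinB; congr EFin; ring.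
rewrite [X in _ = mu X](_ : _ = `[x - c, x - a[%classic); last first.
  apply/seteqP; split => y /=; rewrite !in_itv/= /reflection
      mulr_sign/= =>  /andP[? ?];
      apply/andP; split; lra.
rewrite !lebesgue_measure_itv/= !lte_fin ltrD2l ltrN2; case: ifPn => // _.
by rewrite -!EFinB; congr EFin; ring.
Qed.

Lemma integral_reflection b x (h : R -> \bar R) :
  measurable_fun [set: R] h ->
  (\int[mu]_t h t = \int[mu]_s h (reflection b x s))%E.
Proof.
move=> mh.
have ge0E (k : R -> \bar R) : measurable_fun [set: R] k -> (forall t, 0 <= k t)%E ->
    (\int[mu]_t k t = \int[mu]_s k (reflection b x s))%E.
  move=> mk k0.
  transitivity (\int[pushforward mu
    (reflection b x : measurableTypeR R -> measurableTypeR R)]_t k t)%E.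
    apply: eq_measure_integral => [|mr A mA _]; first exact: measurable_reflection.
    exact/esym/pushforward_reflection.
  rewrite ge0_integral_pushforward//; exact: measurable_reflection.
rewrite integralE [RHS]integralE; congr (_ - _)%E.
- rewrite (ge0E (h ^\+)%E)//; last exact: measurable_funepos.
  apply: eq_integral => s _; rewrite -[RHS]/((h \o reflection b x)^\+%E s).
  by rewrite (funepos_comp h (reflection b x)).
- rewrite (ge0E (h ^\-)%E)//; last exact: measurable_funeneg.
  apply: eq_integral => s _; rewrite -[RHS]/((h \o reflection b x)^\-%E s).
  by rewrite (funeneg_comp h (reflection b x)).
Qed.

(** Null sets pull back to null sets because reflections preserve the measure. *)
Lemma ae_reflection b x (P : R -> Prop) :
  {ae mu, forall t, P t} -> {ae mu, forall s, P (reflection b x s)}.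
Proof.
move=> [N [mN N0 PN]].
exists (reflection b x @^-1` N); split.
- by rewrite -[X in measurable X]setTI; exact: measurable_reflection.
- by rewrite -N0 -(pushforward_reflection b x mN).
- by move=> s /= Ps; exact: PN.
Qed.

End reflection.

Section convolution.
Variable R : realType.
Local Notation mu := (@lebesgue_measure R).
Implicit Types (g x : R) (b : bool) (f F G : R -> R).

(** The interval is long enough for [F] supported in [[-1, 1]] and [x] in
    [[-1, 1]]: then [reflection b x s] leaves the support as soon as [2 < s]. *)
Definition power_conv g b F x :=
  \int[mu]_(s in `[0, 2]) (s `^ (g - 1) * F (reflection b x s)).

Lemma integrable_power_conv g b F x B : 0 < g -> measurable_fun [set: R] F ->
  (forall y, `|F y| <= B) ->
  mu.-integrable `[0, 2] (EFin \o (fun s => s `^ (g - 1) * F (reflection b x s))).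
Proof.
move=> g0 mF FB.
have h0 : mu.-integrable `[0, 2] (fun s : R => B%:E * (s `^ (g - 1))%:E)%E.
  apply: integrableZl => //; exact: integrable_powR_itv0.
apply: le_integrable h0 => //.
- apply/measurable_EFinP/measurable_funM.
    by apply: measurable_funTS; exact: measurable_powR.
  apply: measurable_funTS; apply: measurableT_comp => //.
  exact: measurable_reflection.
- move=> s _ /=; rewrite lee_fin !normrM mulrC ler_wpM2r//.
  by rewrite (le_trans (FB _))// ler_norm.
Qed.

(** Dominated convergence: the difference quotients of [F] are bounded by its
    Lipschitz constant [L], so [L] times the kernel, which is integrable,
    dominates.  Pointwise convergence is only required almost everywhere, which
    leaves room for the corners of [F]. *)
Lemma is_derive_power_conv g b F G (L B : R) x : 0 < g ->
  measurable_fun [set: R] F -> (forall y, `|F y| <= B) ->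
  (forall y z, `|F y - F z| <= L * `|y - z|) ->
  measurable_fun [set: R] G ->
  {ae mu, forall y, is_derive y (1 : R) F (G y)} ->
  is_derive x (1 : R) (power_conv g b F) (power_conv g b G x).
Proof.
move=> g0 mF FB FL mG FG.
have mcomp (H : R -> R) (y : R) : measurable_fun [set: R] H ->
    measurable_fun (`[0%R, 2%R]%classic : set R)
      (fun s : R => s `^ (g - 1) * H (reflection b y s)).
  move=> mH; apply: measurable_funM.
    by apply: measurable_funTS; exact: measurable_powR.
  by apply: measurable_funTS; apply: measurableT_comp => //; exact: measurable_reflection.
suff : h^-1 *: (power_conv g b F (h *: 1 + x) - power_conv g b F x) @[h --> 0^']
    --> power_conv g b G x.
  by move=> h; apply: DeriveDef; [apply/cvg_ex; exists (power_conv g b G x)|exact/cvg_lim].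
apply/cvgr_dnbhsP => t [t0 tcvg].
pose f_ n (s : R) : R :=
  (s `^ (g - 1) * ((F (reflection b (t n + x) s) - F (reflection b x s)) / t n)).
have mI : measurable (`[0%R, 2%R]%classic : set (measurableTypeR R)).
  exact: measurable_itv.
have intF y := integrable_power_conv b y g0 mF FB.
have fE n : (t n)^-1 *: (power_conv g b F (t n *: 1 + x) - power_conv g b F x) =
    fine (\int[mu]_(s in `[0%R, 2%R]) (f_ n s)%:E)%E.
  rewrite scaler1 /power_conv -RintegralB//; try exact: intF.
  rewrite /GRing.scale/= -RintegralZl//.
    by apply: eq_Rintegral => s _; rewrite /f_; ring.
  have h := integrableB mI (intF (t n + x)) (intF x).
  exact: (eq_integrable _ _ _ _ h).
under eq_cvg do rewrite fE.
have dom : mu.-integrable `[0, 2] (fun s : R => L%:E * (s `^ (g - 1))%:E)%E.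
  apply: integrableZl => //; exact: integrable_powR_itv0.
have mf_ n : measurable_fun (`[0%R, 2%R]%classic : set R) (EFin \o f_ n).
  apply/measurable_EFinP; rewrite (_ : f_ n = (fun s =>
    (s `^ (g - 1) * F (reflection b (t n + x) s) -
     s `^ (g - 1) * F (reflection b x s)) * (t n)^-1)); last first.
    by apply/funext => s; rewrite /f_; ring.
  by apply: measurable_funM => //; apply: measurable_funB; exact: mcomp.
have mG' : measurable_fun (`[0%R, 2%R]%classic : set R)
    (EFin \o (fun s => s `^ (g - 1) * G (reflection b x s))).
  by apply/measurable_EFinP; exact: mcomp.
have f_cvg : {ae mu, forall s, s \in `[0%R, 2%R] -> (EFin \o f_ n) s @[n --> \oo]
    --> (EFin \o (fun s => s `^ (g - 1) * G (reflection b x s))) s}.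
  have [N [mN N0 FN]] := ae_reflection b x FG; exists N; split => //.
  apply: subset_trans FN; apply: subsetC => s /= [dF dG] _.
  apply: cvg_EFin; first exact: nearW.
  apply: cvgMl_tmp; rewrite -dG.
  have := dF => /cvg_ex[/= l Fl]; have -> : 'D_1 F (reflection b x s) = l.
    exact: cvg_lim Fl.
  move/cvgr_dnbhsP : Fl => /(_ t (conj t0 tcvg)).
  apply: cvg_trans; apply: near_eq_cvg; apply: nearW => n.
  by rewrite /GRing.scale/= mulr1 mulrC /reflection addrA.
have f_dom : {ae mu, forall s n, s \in `[0%R, 2%R] ->
    (`|(EFin \o f_ n) s| <= L%:E * (s `^ (g - 1))%:E)%E}.
  apply: aeW => s n _; rewrite -EFinM /= lee_fin /f_ normrM mulrC.
  rewrite [`|s `^ _|]ger0_norm ?powR_ge0// ler_wpM2r ?powR_ge0// normrM normfV.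
  rewrite ler_pdivrMr ?normr_gt0// (le_trans (FL _ _))// /reflection.
  by rewrite (_ : t n + x - (-1) ^+ b * s - (x - (-1) ^+ b * s) = t n) //; ring.
have [If _ cf] := dominated_convergence mI mf_ mG' f_cvg dom f_dom.
by apply: fine_cvg; rewrite fineK; [exact: cf|exact: integrable_fin_num].
Qed.

End convolution.

(** * Differentiating the convolution of an extension by zero *)

Section extension.
Variable R : realType.
Local Notation mu := (@lebesgue_measure R).
Implicit Types (g x y : R) (b : bool) (f : R -> R).

Definition clamp y : R := Num.max (-1) (Num.min y 1).

Lemma clamp_itv y : -1 <= clamp y <= 1.
Proof. by rewrite /clamp le_max ge_max lexx ge_min lexx orbT/=; lra. Qed.

Lemma clamp_id y : -1 <= y <= 1 -> clamp y = y.
Proof. by move=> /andP[y0 y1]; rewrite /clamp min_l// max_r. Qed.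

Lemma clamp_lt y : y < -1 -> clamp y = -1.
Proof. by move=> y1; rewrite /clamp min_l ?max_l//; lra. Qed.

Lemma clamp_gt y : 1 < y -> clamp y = 1.
Proof. by move=> y1; rewrite /clamp min_r ?max_r//; lra. Qed.

Lemma clamp_lipschitz y z : `|clamp y - clamp z| <= `|y - z|.
Proof.
wlog yz : y z / y <= z => [H|].
  by have [/H//|/ltW/H] := leP y z; rewrite distrC [leRHS]distrC.
rewrite (distrC y) (ger0_norm (_ : 0 <= z - y)) ?subr_ge0//.
rewrite distrC ger0_norm; rewrite /clamp /Num.max /Num.min;
  do !case: ifPn; rewrite -?leNgt; lra.
Qed.

Lemma measurable_clamp : measurable_fun [set: R] clamp.
Proof. by apply: measurable_maxr => //; exact: measurable_minr. Qed.

Definition extension f : R -> R := f \_ `[-1, 1].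

Lemma extension_in f y : -1 <= y <= 1 -> extension f y = f y.
Proof. by move=> y1; rewrite /extension patchE mem_setE in_itv/= y1. Qed.

Lemma extension_out f y : ~~ (-1 <= y <= 1) -> extension f y = 0.
Proof. by move=> y1; rewrite /extension patchE mem_setE in_itv/= (negbTE y1). Qed.

Lemma measurable_extension f : {within `[-1, 1], continuous f} ->
  measurable_fun [set: R] (extension f).
Proof.
move=> cf; apply/(measurable_restrictT f) => //.
by apply: subspace_continuous_measurable_fun.
Qed.

Lemma continuous_bounded_itv f : {within `[-1, 1], continuous f} ->
  exists2 B, 0 <= B & forall y, -1 <= y <= 1 -> `|f y| <= B.
Proof.
move=> cf; have le11 : -1 <= 1 :> R by lra.
have [c _ fc] := EVT_max le11 cf; have [d _ fd] := EVT_min le11 cf.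
exists (`|f c| + `|f d|); first by rewrite addr_ge0.
move=> y y1; have /fc yc : y \in `[-1, 1] by rewrite in_itv.
have /fd yd : y \in `[-1, 1] by rewrite in_itv.
have := ler_norm (f c); have := ler_norm (- f d); rewrite normrN => h1 h2.
have := normr_ge0 (f c); have := normr_ge0 (f d) => h3 h4.
by rewrite ler_norml; apply/andP; split; lra.
Qed.

Lemma bounded_extension f B : 0 <= B -> (forall y, -1 <= y <= 1 -> `|f y| <= B) ->
  forall y, `|extension f y| <= B.
Proof.
move=> B0 fB y; have [y1|y1] := boolP (-1 <= y <= 1).
  by rewrite extension_in// fB.
by rewrite extension_out// normr0.
Qed.

Lemma measurable_clamp_comp f : {within `[-1, 1], continuous f} ->
  measurable_fun [set: R] (f \o clamp).
Proof.
move=> cf; rewrite (_ : f \o clamp = extension f \o clamp).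
  apply: measurableT_comp; [exact: measurable_extension|exact: measurable_clamp].
by apply/funext => y /=; rewrite extension_in// clamp_itv.
Qed.

Lemma lipschitz_clamp_comp f L : (forall y, -1 <= y <= 1 -> derivable f y 1) ->
  (forall y, -1 <= y <= 1 -> `|derive1 f y| <= L) ->
  forall y z, `|f (clamp y) - f (clamp z)| <= L * `|y - z|.
Proof.
move=> df fL y z.
have L0 : 0 <= L by apply: le_trans (fL 0 _); [exact: normr_ge0|lra].
have fL' a c : -1 <= a -> a <= c -> c <= 1 -> `|f c - f a| <= L * `|c - a|.
  move=> a1 ac c1.
  have [t| |t] := @MVT_segment _ f (derive1 f) a c ac.
  - rewrite in_itv/= => /andP[at_ tc]; have t1 : -1 <= t <= 1 by lra.
    by apply: DeriveDef; [exact: df|rewrite derive1E].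
  - apply: derivable_within_continuous => t; rewrite in_itv/= => /andP[at_ tc].
    by apply: df; lra.
  - rewrite in_itv/= => /andP[at_ tc] ->.
    by rewrite normrM ler_wpM2r// fL//; lra.
have /andP[y0 y1] := clamp_itv y; have /andP[z0 z1] := clamp_itv z.
apply: (@le_trans _ _ (L * `|clamp y - clamp z|)); last first.
  by rewrite ler_wpM2l// clamp_lipschitz.
have [yz|/ltW zy] := leP (clamp y) (clamp z); last exact: fL'.
by rewrite distrC [in leRHS]distrC fL'.
Qed.

(** [f \o clamp] is constant outside [[-1, 1]], where the extension of the
    derivative is zero; it has corners at the two ends. *)
Lemma is_derive_clamp_comp f y : (forall y, -1 <= y <= 1 -> derivable f y 1) ->
  y != -1 -> y != 1 ->
  is_derive y (1 : R) (f \o clamp) (extension (derive1 f) y).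
Proof.
move=> df yN1 y1.
have [{}yN1|{}yN1|//] := ltgtP y (-1); last by move: yN1 => /eqP.
  rewrite extension_out; last by rewrite negb_and -ltNge yN1.
  apply: (@near_eq_is_derive _ _ _ (cst (f (-1)))).
  near=> z; rewrite /= clamp_lt//; near: z; exact: lt_nbhsl.
have [{}y1|{}y1|] := ltgtP y 1; last by move: y1 => /eqP.
  rewrite extension_in; last by rewrite !ltW.
  apply: (@near_eq_is_derive _ _ _ f).
    near=> z; rewrite /= clamp_id//; apply/andP; split; apply/ltW; near: z.
      exact: lt_nbhsr.
    exact: lt_nbhsl.
  by apply: DeriveDef; [apply: df; rewrite !ltW|rewrite derive1E].
rewrite extension_out; last by rewrite negb_and -!ltNge y1 orbT.
apply: (@near_eq_is_derive _ _ _ (cst (f 1))).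
near=> z; rewrite /= clamp_gt//; near: z; exact: lt_nbhsr.
Unshelve. all: by end_near. Qed.

Lemma ae_neq_itv_ends : {ae mu, forall y : R, y != -1 /\ y != 1}.
Proof.
exists [set -1; 1]; split.
- exact: measurableU.
- apply: countable_lebesgue_measure0; apply: finite_set_countable.
  by rewrite finite_setU; split; exact: finite_set1.
- move=> y /= y1; apply: contrapT => /not_orP[yN1 y11].
  by apply: y1; split; apply/eqP.
Qed.

Lemma ae_is_derive_clamp_comp f : (forall y, -1 <= y <= 1 -> derivable f y 1) ->
  {ae mu, forall y, is_derive y (1 : R) (f \o clamp) (extension (derive1 f) y)}.
Proof.
move=> df; have [N [mN N0 sN]] := ae_neq_itv_ends; exists N; split => //.
by apply: subset_trans sN; apply: subsetC => y [? ?]; exact: is_derive_clamp_comp.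
Qed.

(** From a point inside, [reflection b x s] can only leave [[-1, 1]] through the
    base point [- (-1) ^+ b], beyond which [f \o clamp] keeps the value zero. *)
Lemma power_conv_clamp_comp g b f x : f (- (-1) ^+ b) = 0 -> -1 < x < 1 ->
  power_conv g b (f \o clamp) x = power_conv g b (extension f) x.
Proof.
move=> f0 /andP[x0 x1]; apply: eq_Rintegral => s.
rewrite inE/= in_itv/= => /andP[s0 s2]; congr (_ * _).
have [y1|] := boolP (-1 <= reflection b x s <= 1).
  by rewrite extension_in// clamp_id.
move=> y1; rewrite extension_out//=.
move: y1 f0; rewrite negb_and -!ltNge /reflection mulr_sign.
case: b => /= /orP[] h f0.
- lra.
- by rewrite clamp_gt// -[RHS]f0 opprK.
- by rewrite clamp_lt// -[RHS]f0.
- lra.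
Qed.

(** Without [f (- (-1) ^+ b) = 0] the extension by zero would jump at the base
    point, and the derivative would get a boundary term that is singular there. *)
Lemma is_derive_power_conv_extension g b f x : 0 < g ->
  (forall y, -1 <= y <= 1 -> derivable f y 1) ->
  {within `[-1, 1], continuous (derive1 f)} ->
  f (- (-1) ^+ b) = 0 -> -1 < x < 1 ->
  is_derive x (1 : R) (power_conv g b (extension f))
    (power_conv g b (extension (derive1 f)) x).
Proof.
move=> g0 df cdf f0 /andP[x0 x1].
have cf : {within `[-1, 1], continuous f}.
  by apply: derivable_within_continuous => y; rewrite in_itv => /df.
have [B B0 fB] := continuous_bounded_itv cf.
have [L L0 fL] := continuous_bounded_itv cdf.
apply: (@near_eq_is_derive _ _ _ (power_conv g b (f \o clamp))).
  near=> z; apply: power_conv_clamp_comp => //; apply/andP; split; near: z.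
    exact: lt_nbhsr.
  exact: lt_nbhsl.
apply: (@is_derive_power_conv _ _ _ _ _ L B) => //.
- exact: measurable_clamp_comp.
- by move=> y; exact/fB/clamp_itv.
- exact: lipschitz_clamp_comp.
- exact: measurable_extension.
- exact: ae_is_derive_clamp_comp.
Unshelve. all: by end_near. Qed.

End extension.

(** * Fractional integrals and the sup-norm bound *)

Section fractional.
Variable R : realType.
Local Notation mu := (@lebesgue_measure R).
Implicit Types (g x y B M : R) (b : bool) (f : R -> R).

Lemma norm_power_conv_le g b (F : R -> R) x B M : 0 < g -> 0 <= M ->
  measurable_fun [set: R] F ->
  (forall y, `|F y| <= B) -> {ae mu, forall y, `|F y| <= M} ->
  `|power_conv g b F x| <= M * (2 `^ g / g).
Proof.
move=> g0 M0 mF FB FM.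
have mI : measurable (`[0%R, 2%R]%classic : set (measurableTypeR R)).
  exact: measurable_itv.
have intF := integrable_power_conv b x g0 mF FB.
apply: (le_trans (le_normr_Rintegral mI intF)).
have intN := integrable_norm intF.
rewrite -lee_fin /Rintegral fineK; last first.
  exact: (integrable_fin_num mI intN).
have mp : measurable_fun (`[0%R, 2%R]%classic : set R) (fun s : R => s `^ (g - 1)).
  by apply: measurable_funTS; exact: measurable_powR.
apply: (@le_trans _ _ (\int[mu]_(s in `[0%R, 2%R]) (M%:E * (s `^ (g - 1))%:E))%E).
  apply: ae_ge0_le_integral => //.
  - exact: measurable_int intN.
  - by move=> s _; rewrite -EFinM lee_fin mulr_ge0 ?powR_ge0.
  - apply/measurable_EFinP; exact: measurable_funM.
  - have [N [mN N0 sN]] := ae_reflection b x FM; exists N; split => //.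
    apply: subset_trans sN; apply: subsetC => s /= h _.
    rewrite -EFinM lee_fin normrM ger0_norm ?powR_ge0// mulrC.
    by rewrite ler_wpM2r ?powR_ge0.
rewrite ge0_integralZl//=.
- by rewrite integral_powR_itv0.
- by apply/measurable_EFinP.
- by move=> s _; rewrite lee_fin powR_ge0.
Qed.

Lemma Linfty_normE f :
  Linfty_norm f = ess_sup mu (fun y => (`|extension f y|)%:E).
Proof.
rewrite /Linfty_norm unlock ifT; last first.
  suff : (0 < mu [set: R])%E by [].
  by rewrite -set_itvNyy lebesgue_measure_itv /= addey// ltry.
congr ess_sup; apply/funext => y /=.
by rewrite /extension !patchE; case: ifPn => // _; rewrite normr0.
Qed.

Lemma Linfty_norm_bounded f B : 0 <= B -> (forall y, `|extension f y| <= B) ->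
  exists2 M, 0 <= M &
    Linfty_norm f = M%:E /\ {ae mu, forall y, `|extension f y| <= M}.
Proof.
move=> B0 fB.
have : (0 <= Linfty_norm f)%E by exact: Lnorm_ge0.
have : (Linfty_norm f <= B%:E)%E.
  by rewrite Linfty_normE; apply/ess_supP; apply: aeW => y; rewrite lee_fin.
case E : (Linfty_norm f) => [M| |]// _ M0; exists M => //; split => //.
have /ess_supP : (ess_sup mu (fun y => (`|extension f y|)%:E) <= M%:E)%E.
  by rewrite -Linfty_normE E.
move=> [N [mN N0 sN]]; by exists N; split.
Qed.

(** The end points form a null set, so a bound on the open interval suffices. *)
Lemma Linfty_norm_le f M : 0 <= M -> (forall y, -1 < y < 1 -> `|f y| <= M) ->
  (Linfty_norm f <= M%:E)%E.
Proof.
move=> M0 fM; rewrite Linfty_normE; apply/ess_supP.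
have [N [mN N0 sN]] := @ae_neq_itv_ends R; exists N; split => //.
apply: subset_trans sN; apply: subsetC => y /= [yN1 y1]; rewrite lee_fin.
have [yI|yI] := boolP (-1 <= y <= 1); last by rewrite extension_out// normr0.
rewrite extension_in// fM//; move: yI.
by rewrite !le_eqVlt eq_sym (negbTE yN1) (negbTE y1).
Qed.

Definition RL_integral b g f : R -> R :=
  if b then right_RL_integral g f else left_RL_integral g f.

(** Both sides are the integral over the whole line of one function, [h] below,
    once the zero extension of [f] and the cut-off of the kernel at 0 take over
    the role of the domains of integration. *)
Lemma RL_integralE b g f x : g < 1 -> measurable_fun [set: R] (extension f) ->
  -1 <= x <= 1 ->
  RL_integral b g f x = (Gamma g)^-1 * power_conv g b (extension f) x.
Proof.
move=> g1 mf /andP[x0 x1].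
pose k := (fun r : R => r `^ (g - 1)) \_ `[0, +oo[.
have kE r : k r = if 0 <= r then r `^ (g - 1) else 0.
  by rewrite /k patchE mem_setE in_itv/= andbT.
have mk : measurable_fun [set: R] k.
  apply/(measurable_restrictT (fun r : R => r `^ (g - 1))) => //.
  by apply: measurable_funTS; exact: measurable_powR.
pose h t := extension f t * k ((-1) ^+ b * (x - t)).
have mh : measurable_fun [set: R] h.
  apply: measurable_funM => //; apply: measurableT_comp => //.
  by apply: measurable_funM => //; exact: measurable_funB.
have kerE (D : set R) (d : R -> R) : (forall t, (f t / (d t) `^ (1 - g)) * \1_D t = h t) ->
    \int[mu]_(t in D) (f t / (d t) `^ (1 - g)) = power_conv g b (extension f) x.
  move=> dh; rewrite Rintegral_mkcond /power_conv [RHS]Rintegral_mkcond.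
  transitivity (\int[mu]_t h t).
    apply: eq_Rintegral => t _; rewrite -dh patchE indicE.
    by case: ifPn; rewrite ?mulr1 ?mulr0.
  congr fine; rewrite (@integral_reflection _ b x (EFin \o h)); last first.
    exact/measurable_EFinP.
  apply: eq_integral => s _; congr EFin.
  rewrite patchE mem_setE in_itv/= /h kE /reflection.
  rewrite (_ : (-1) ^+ b * (x - (x - (-1) ^+ b * s)) = s); last first.
    by rewrite subKr mulrA -expr2 sqrr_sign mul1r.
  have [s0|s0] := leP 0 s; last by rewrite mulr0.
  have [s2|s2] := leP s 2; first by rewrite mulrC.
  rewrite extension_out ?mul0r// mulr_sign.
  by case: (b); rewrite negb_and -!ltNge; apply/orP; [right|left]; lra.
rewrite /RL_integral /right_RL_integral /left_RL_integral.
have powE r : (r `^ (1 - g))^-1 = r `^ (g - 1) by rewrite -powRN opprB.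
case: b @h mh kerE => h mh kerE; congr (_ * _); apply: kerE => t.
- rewrite powE /h kE indicE mem_setE in_itv/= mulN1r opprB subr_ge0.
  have [xt|xt] := leP x t; last by rewrite !mulr0.
  have [t1|t1] := leP t 1; first by rewrite mulr1 extension_in// t1; lra.
  by rewrite mulr0 extension_out ?mul0r// negb_and -!ltNge t1 orbT.
- rewrite powE /h kE indicE mem_setE in_itv/= mul1r subr_ge0 andbC.
  have [xt|xt] := leP t x; last by rewrite !mulr0.
  have [t1|t1] := leP (-1) t; first by rewrite mulr1 extension_in// t1; lra.
  by rewrite mulr0 extension_out ?mul0r// negb_and -!ltNge t1.
Qed.

Section smooth.
Variables (b : bool) (g : R) (e : R -> R) (k : nat).
Hypotheses (g0 : 0 < g) (g1 : g < 1).
Hypothesis es : forall j y, -1 <= y <= 1 -> derivable (derive1n j e) y 1.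
Hypothesis e0 : forall j, (j <= k)%N -> derive1n j e (- (-1) ^+ b) = 0.

Lemma within_continuous_derive1n j : {within `[-1, 1], continuous (derive1n j e)}.
Proof.
by apply: derivable_within_continuous => y; rewrite in_itv => /es.
Qed.

Lemma is_derive_RL j x : (j <= k)%N -> -1 < x < 1 ->
  is_derive x (1 : R)
    (fun x => (Gamma g)^-1 * power_conv g b (extension (derive1n j e)) x)
    ((Gamma g)^-1 * power_conv g b (extension (derive1n j.+1 e)) x).
Proof.
move=> jk x1.
have d : is_derive x (1 : R) (power_conv g b (extension (derive1n j e)))
    (power_conv g b (extension (derive1n j.+1 e)) x).
  apply: is_derive_power_conv_extension => //.
  - exact: es.
  - exact: (@within_continuous_derive1n j.+1).
  - exact: e0.
exact: is_deriveZ.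
Qed.

(** Induction on the order: each step needs the previous derivative of [e] to
    vanish at the base point, hence the limit [k + 1]. *)
Lemma derive1n_RL_integral j x : (j <= k.+1)%N -> -1 < x < 1 ->
  derive1n j (RL_integral b g e) x =
  (Gamma g)^-1 * power_conv g b (extension (derive1n j e)) x.
Proof.
elim: j x => [|j IH] x jk x1.
  apply: RL_integralE => //.
    by apply: measurable_extension; exact: (@within_continuous_derive1n 0).
  by case/andP: x1 => ? ?; rewrite !ltW.
rewrite derive1nS derive1E.
rewrite (near_eq_derive (g := fun x =>
    (Gamma g)^-1 * power_conv g b (extension (derive1n j e)) x)).
  have := is_derive_RL jk x1 => d.
  exact: derive_val.
have /andP[x0 x2] := x1.
near=> z; apply: IH; first exact: ltnW.
by apply/andP; split; near: z; [exact: lt_nbhsr|exact: lt_nbhsl].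
Unshelve. all: by end_near. Qed.

Lemma RL_integral_derivable : derivable_n_in k.+1 (RL_integral b g e) `]-1, 1[.
Proof.
move=> j jk x /=; rewrite in_itv/= => /[dup] x1 /andP[x0 x2].
apply: (@near_eq_derivable _ _ _
  (fun x => (Gamma g)^-1 * power_conv g b (extension (derive1n j e)) x)).
  near=> z; apply/esym/derive1n_RL_integral; first exact: ltnW.
  by apply/andP; split; near: z; [exact: lt_nbhsr|exact: lt_nbhsl].
by have [] := is_derive_RL jk x1.
Unshelve. all: by end_near. Qed.

(** [D] is only known up to sign, so as to cover the factor [(-1) ^+ k.+1] in the
    right-sided derivative. *)
Lemma Linfty_RL_derivative (D : R -> R) :
  (forall x, `|D x| = `|derive1n k.+1 (RL_integral b g e) x|) ->
  (Linfty_norm D <= (2 `^ g / Gamma (g + 1))%:E * Linfty_norm (derive1n k.+1 e))%E.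
Proof.
move=> DE.
have cf := @within_continuous_derive1n k.+1.
have [B B0 fB] := continuous_bounded_itv cf.
have fB' := bounded_extension B0 fB.
have [M M0 [-> aeM]] := Linfty_norm_bounded B0 fB'.
have G0 : 0 <= Gamma g.
  apply: fine_ge0; apply: integral_ge0 => t _.
  by rewrite lee_fin mulr_ge0 ?powR_ge0 ?expR_ge0.
rewrite -EFinM; apply: Linfty_norm_le.
  by rewrite Gamma_functional// !mulr_ge0 ?invr_ge0 ?mulr_ge0 ?powR_ge0// ltW.
move=> y y1; rewrite DE derive1n_RL_integral// normrM ger0_norm ?invr_ge0//.
rewrite Gamma_functional// invfM.
have -> : 2 `^ g * (g^-1 * (Gamma g)^-1) * M = (Gamma g)^-1 * (M * (2 `^ g / g)) by ring.
rewrite ler_wpM2l ?invr_ge0//.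
by apply: norm_power_conv_le fB' aeM => //; exact: measurable_extension.
Qed.

End smooth.
End fractional.

(** * The error of one-point Hermite interpolation *)

Section hermite.
Variables (R : realType) (k : nat) (alpha : R) (u : R -> R) (p : {poly R}).
Hypotheses (halpha : k%:R < alpha < k.+1%:R) (hu : analytic_on `[-1, 1] u).
Let e := fun t : R => u t - p.[t].

Lemma RL_hermite_error (b : bool) :
  (forall j, (j <= k)%N -> p^`(j).[- (-1) ^+ b] = derive1n j u (- (-1) ^+ b)) ->
  (derivable_n_in k.+1 (RL_integral b (k.+1%:R - alpha) e) `]-1, 1[) /\
  forall D : R -> R,
    (forall x, `|D x| = `|derive1n k.+1 (RL_integral b (k.+1%:R - alpha) e) x|) ->
    (Linfty_norm D <=
     (2 `^ (k.+1%:R - alpha) / Gamma (k.+2%:R - alpha))%:E *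
     Linfty_norm (derive1n k.+1 e))%E.
Proof.
move=> up; set g := k.+1%:R - alpha.
have g0 : 0 < g by case/andP: halpha; rewrite /g; lra.
have g1 : g < 1 by case/andP: halpha; rewrite /g -natr1; lra.
have us (y : R) : -1 <= y <= 1 -> smooth_at u y.
  by move=> y1; apply: analytic_smooth hu _; rewrite /= in_itv.
have es (j : nat) (y : R) : -1 <= y <= 1 -> derivable (derive1n j e) y 1.
  by move=> /us/(smooth_subr_horner p)/(_ j)/nbhs_singleton.
have e0 j : (j <= k)%N -> derive1n j e (- (-1) ^+ b) = 0.
  move=> jk; have c1 : -1 <= (- (-1) ^+ b : R) <= 1.
    by rewrite -[(-1) ^+ b]mulr1 mulr_sign; case: (b); lra.
  have := nbhs_singleton (smooth_near_derive1n_subr_horner p j (us _ c1)).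
  by rewrite up// subrr.
split; first exact: RL_integral_derivable.
move=> D DE; rewrite (_ : k.+2%:R - alpha = g + 1); last first.
  by rewrite /g -natr1; ring.
exact: (Linfty_RL_derivative g0 g1 es e0 DE).
Qed.
End hermite.

Theorem theorem4p2 (R : realType) (k N : nat) (alpha : R) (u : R -> R)
    (hkN : (k <= N)%N) (halpha : k%:R < alpha < k.+1%:R)
    (hu : analytic_on `[-1, 1] u) :
  (forall (x : 'I_(N - k).+1 -> R) (uNL : {poly R}),
     left_nodes k x -> left_hermite_interpolant x u uNL ->
     let e := fun t : R => u t - uNL.[t] in
     left_RL_derivable k alpha e /\
     (Linfty_norm (left_RL_derivative k alpha e) <=
      (2 `^ (k.+1%:R - alpha) / Gamma (k.+2%:R - alpha))%:E *
      Linfty_norm (derive1n k.+1 e))%E) /\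
  (forall (x : 'I_(N - k).+1 -> R) (uNR : {poly R}),
     right_nodes k x -> right_hermite_interpolant x u uNR ->
     let e := fun t : R => u t - uNR.[t] in
     right_RL_derivable k alpha e /\
     (Linfty_norm (right_RL_derivative k alpha e) <=
      (2 `^ (k.+1%:R - alpha) / Gamma (k.+2%:R - alpha))%:E *
      Linfty_norm (derive1n k.+1 e))%E).
Proof.
split=> x p _ [_ hp _] e.
- have [d n] := RL_hermite_error (b := false) halpha hu hp.
  by split; [exact: d|exact: n].
- have hp' j : (j <= k)%N ->
      p^`(j).[- (-1) ^+ true] = derive1n j u (- (-1) ^+ true).
    by rewrite expr1 opprK => /hp.
  have [d n] := RL_hermite_error halpha hu hp'.
  split; first exact: d.
  by apply: n => y; rewrite /right_RL_derivative normrM normrX normrN1 expr1n mul1r.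
Qed.
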